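(* Let $(A,\circ,B(\cdot,\cdot))$ be a quadratic Novikov algebra over $\mathbf{k}$ and let $D$ be a derivation of $(A,\circ)$ such that $B(D(a),b)=-B(a,D(b))$ for all $a,b\in A$. Define $\omega(\cdot,\cdot):A\times A\to\mathbf{k}$ by $\omega(a,b)=B(D(a),b)$ for all $a,b\in A$. Then $\omega(\cdot,\cdot)$ is a skewsymmetric bilinear form satisfying $$\omega(a\circ b,c)-\omega(a\star c,b)+\omega(c\circ b,a)=0\quad\text{for all } a,b,c\in A.$$
   Context: $\mathbf{k}$ is a field of characteristic zero; all vector spaces and algebras are finite-dimensional over $\mathbf{k}$. A Novikov algebra $(A,\circ)$ is a vector space with a bilinear operation $\circ$ such that $(a\circ b)\circ c-a\circ(b\circ c)=(b\circ a)\circ c-b\circ(a\circ c)$ and $(a\circ b)\circ c=(a\circ c)\circ b$ for all $a,b,c\in A$. Put $a\star b:=a\circ b+b\circ a$. A quadratic Novikov algebra $(A,\circ,B(\cdot,\cdot))$ is a Novikov algebra with a nondegenerate symmetric bilinear form $B:A\times A\to\mathbf{k}$ such that $B(a\circ b,c)=-B(b,a\star c)$ for all $a,b,c\in A$. A derivation of $(A,\circ)$ is a linear map $D:A\to A$ with $D(a\circ b)=D(a)\circ b+a\circ D(b)$ for all $a,b\in A$. A bilinear form $\omega$ is skewsymmetric if $\omega(a,b)=-\omega(b,a)$ for all $a,b$. *)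

(* Defs.v *)
From mathcomp Require Import all_boot all_algebra.

Set Implicit Arguments.
Unset Strict Implicit.
Unset Printing Implicit Defensive.

Import GRing.Theory.
Local Open Scope ring_scope.

Section NovikovAlgebra.

Variables (k : fieldType) (A : vectType k).
Implicit Types (op : {bilinear A -> A -> A}) (B : {symmetric A}).

Definition novikov op : Prop :=
  (forall a b c,
     op (op a b) c - op a (op b c) = op (op b a) c - op b (op a c)) /\
  (forall a b c, op (op a b) c = op (op a c) b).

Definition star op (a b : A) : A := op a b + op b a.

(* Symmetry and bilinearity of [B] are carried by its type. *)
Definition quadratic_novikov op B : Prop :=
  [/\ novikov op,
      nondegenerate B
    & forall a b c, B (op a b) c = - B b (star op a c)].

Definition derivation op (D : {linear A -> A}) : Prop :=
  forall a b, D (op a b) = op (D a) b + op a (D b).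

Definition skewsymmetric (f : A -> A -> k) : Prop :=
  forall a b, f a b = - f b a.

End NovikovAlgebra.

(* Main.v *)
Require Import Defs.
From mathcomp Require Import all_boot all_algebra.
Import GRing.Theory.
Local Open Scope ring_scope.

(* Invariance and skewness of D give omega(a∘b, c) = B(b, a⋆D(c)); since D is also a
   derivation of ⋆, omega(a⋆c, b) = B(b, a⋆D(c)) + B(b, c⋆D(a)), which is the sum of
   the two other terms. *)
Theorem proposition2p10 (k : fieldType) (k_char0 : [pchar k] =i pred0)
    (A : vectType k) (op : {bilinear A -> A -> A}) (B : {symmetric A})
    (AB_quadratic : quadratic_novikov op B)
    (D : {linear A -> A}) (D_derivation : derivation op D)
    (D_skew : forall a b : A, B (D a) b = - B a (D b))
    (omega : A -> A -> k) (omegaE : forall a b : A, omega a b = B (D a) b) :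
  [/\ bilinear_for *%R *%R omega,
      skewsymmetric omega
    & forall a b c : A,
        omega (op a b) c - omega (star op a c) b + omega (op c b) a = 0].
Proof.
have [_ _ B_op] := AB_quadratic.
(* A symmetric form is a hermitian form with sign exponent 0 and identity twist, so [hermC] reduces
   to plain symmetry. *)
have BC x y : B x y = B y x by rewrite hermC expr0 mul1r.
have omega_op a b c : omega (op a b) c = B b (star op a (D c)).
  by rewrite omegaE D_skew B_op opprK.
have D_star a c : D (star op a c) = star op a (D c) + star op c (D a).
  (* The four Leibniz terms are regrouped by whether they contain [D c] or [D a]; each pair is one
     star product. *)
  rewrite /star linearD !D_derivation /= [op (D a) c + _]addrC addrACA.
  by congr (_ + _); rewrite addrC.
have omega_star a b c :
    omega (star op a c) b = B b (star op a (D c)) + B b (star op c (D a)).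
  by rewrite omegaE D_star BC linearDr.
split.
- by split=> z x u v; rewrite !omegaE ?linearP ?linearPl ?linearPr.
- by move=> a b; rewrite !omegaE D_skew BC.
(* The third term is the first with [a] and [c] exchanged, so it becomes [B b (star op c (D a))]. *)
move=> a b c; rewrite !omega_op omega_star.
by rewrite opprD addrA subrr add0r addNr.
Qed.
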